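(* Let $\kappa$ be an uncountable regular cardinal with $2^{<\kappa}=\kappa$, and let $X$ be a nonempty regular Hausdorff space of weight at most $\kappa$. Given any $1\le\alpha<\operatorname{ord}_{\kappa^+}(X)$, let $\widehat{\alpha}=\operatorname{cof}(\kappa)=\kappa$ if $\alpha$ is a successor ordinal, and $\widehat{\alpha}=\operatorname{cof}(\alpha)$ if $\alpha$ is limit. Then: (1) $\kappa^+\text{-}\boldsymbol{\Sigma}^0_\alpha(X)$ is neither closed under complements, nor under intersections of size $\widehat{\alpha}$; (2) $\kappa^+\text{-}\boldsymbol{\Pi}^0_\alpha(X)$ is neither closed under complements, nor under unions of size $\widehat{\alpha}$; (3) if $\alpha>1$, then $\kappa^+\text{-}\boldsymbol{\Delta}^0_\alpha(X)$ is not closed under unions or intersections of size $\widehat{\alpha}$ (neither of the two), and the same is true for $\alpha=1$ if $X\subseteq{}^{\kappa}2$.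
   Context: For a topological space $X$, define by recursion on ordinals $\alpha\ge1$: $\kappa^+\text{-}\boldsymbol{\Sigma}^0_1(X)$ is the family of open sets; for $\alpha>1$, $\kappa^+\text{-}\boldsymbol{\Sigma}^0_\alpha(X)$ is the family of all unions of at most $\kappa$-many sets from $\bigcup_{1\le\beta<\alpha}\kappa^+\text{-}\boldsymbol{\Pi}^0_\beta(X)$; $\kappa^+\text{-}\boldsymbol{\Pi}^0_\alpha(X)$ is the family of complements of sets in $\kappa^+\text{-}\boldsymbol{\Sigma}^0_\alpha(X)$; $\kappa^+\text{-}\boldsymbol{\Delta}^0_\alpha(X)=\kappa^+\text{-}\boldsymbol{\Sigma}^0_\alpha(X)\cap\kappa^+\text{-}\boldsymbol{\Pi}^0_\alpha(X)$. $\kappa^+\text{-}\mathbf{Bor}(X)$ is the smallest family of subsets of $X$ containing the open sets and closed under complements and unions of size at most $\kappa$. Then $\operatorname{ord}_{\kappa^+}(X)=\min\{\alpha\mid\kappa^+\text{-}\boldsymbol{\Sigma}^0_\alpha(X)=\kappa^+\text{-}\mathbf{Bor}(X)\}$ (which is at most $\kappa^+$). The space ${}^{\kappa}2$ carries the bounded topology, generated by the sets $[s]=\{x\in{}^{\kappa}2\mid s\subseteq x\}$ for $s\in{}^{<\kappa}2$, and subsets of it carry the subspace topology. *)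

(* Defs.v *)
From HB Require Import structures.
From mathcomp Require Import all_boot all_order all_classical wochoice.
From mathcomp Require Import topology.

Set Implicit Arguments.
Unset Strict Implicit.
Unset Printing Implicit Defensive.

Local Open Scope classical_set_scope.
Local Open Scope card_scope.

(* An ordinal is given by a well-ordered type of that order type, so [ord_eq]
   (order isomorphism) is the equality of ordinals; everything below depends
   on an ordinal only up to [ord_eq].  [Ord] lives one universe above the types
   it classifies; families of ordinals are [Ord -> Prop] rather than [set Ord],
   which would raise the universe of [set] above that of the carriers. *)
Record Ord := MkOrd {
  ocar :> Type;
  leo : rel ocar;
  leo_wo : well_order leo }.

Definition lto (a : Ord) (x y : a) : bool := ~~ leo y x.

Definition ord_eq (a b : Ord) : Prop :=
  exists2 f : a -> b, bijective f & {mono f : x y / leo x y}.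

Definition ord_le (a b : Ord) : Prop :=
  exists2 f : a -> b, {mono f : x y / leo x y} &
    forall x y, leo y (f x) -> range f y.

Definition ord_lt (a b : Ord) : Prop :=
  exists2 f : a -> b, {mono f : x y / leo x y} &
    exists c, range f = [set y | lto y c].

Section OrdOrder.
Implicit Types a b c : Ord.

Lemma leo_min a (P : a -> Prop) : (exists x, P x) ->
  exists2 x, P x & forall y, P y -> leo x y.
Proof.
move=> [x Px]; have [|z [[zP zm] _]] := @leo_wo a (fun x => `[< P x >]).
  by exists x; apply/asboolP.
exists z; first exact/asboolP.
by move=> y /asboolP Py; exact: zm.
Qed.

Lemma leo_total a : total (@leo a).
Proof.
move=> x y.
have [|z [->|->] zm] := @leo_min a (fun u => u = x \/ u = y).
- by exists x; left.
- by rewrite zm//; right.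
- by rewrite [X in _ || X]zm ?orbT//; left.
Qed.

Lemma leoxx a (x : a) : leo x x.
Proof. by have := leo_total x x; rewrite orbb. Qed.

Lemma leo_anti a (x y : a) : leo x y -> leo y x -> x = y.
Proof.
move=> xy yx.
have [|z [_ zu]] := @leo_wo a (fun u => `[< u = x \/ u = y >]).
  by exists x; apply/asboolP; left.
have mP t : t = x \/ t = y -> minimum_of (@leo a) (fun u => `[< u = x \/ u = y >]) t.
  move=> txy; split; first exact/asboolP.
  move=> u /asboolP uxy.
  by case: txy => ->; case: uxy => -> //; rewrite leoxx.
by rewrite -(zu _ (mP x (or_introl erefl))) -(zu _ (mP y (or_intror erefl))).
Qed.

Lemma leo_trans a (y x z : a) : leo x y -> leo y z -> leo x z.
Proof.
move=> xy yz.
have [|t tP tm] := @leo_min a (fun u => [\/ u = x, u = y | u = z]).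
  by exists x; constructor 1.
have tx : leo t x by apply: tm; constructor 1.
have ty : leo t y by apply: tm; constructor 2.
have tz : leo t z by apply: tm; constructor 3.
case: tP => tE; rewrite -?tE//.
- by rewrite (leo_anti xy) // -tE.
- by rewrite tE -(leo_anti yz) // -tE.
Qed.

Lemma ltoW a (x y : a) : lto x y -> leo x y.
Proof. by rewrite /lto; have := leo_total x y; case: (leo y x); rewrite ?orbF. Qed.

Lemma leo_eqVlt a (x y : a) : leo x y -> x = y \/ lto x y.
Proof.
move=> xy; rewrite /lto; have [yx|] := boolP (leo y x); last by right.
by left; exact: leo_anti.
Qed.

Lemma lto_trans a (y x z : a) : lto x y -> lto y z -> lto x z.
Proof. by move=> xy yz; apply/negP => zx; case/negP: yz; exact: (leo_trans zx (ltoW xy)). Qed.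

Lemma leNo a (x y : a) : ~ lto x y -> leo y x.
Proof. by rewrite /lto => /negP; rewrite negbK. Qed.

Lemma lto_ind a (P : a -> Prop) :
  (forall x, (forall y, lto y x -> P y) -> P x) -> forall x, P x.
Proof.
move=> IH x; apply: contrapT => nPx.
have [z nPz zm] := @leo_min a (fun u => ~ P u) (ex_intro _ x nPx).
by apply/nPz/IH => y yz; apply: contrapT => /zm; apply/negP.
Qed.

Lemma mono_inj_leo a b (f : a -> b) : {mono f : x y / leo x y} -> injective f.
Proof. by move=> fm x y fxy; apply: leo_anti; rewrite -fm fxy leoxx. Qed.

Lemma mono_lto a b (f : a -> b) : {mono f : x y / leo x y} ->
  {mono f : x y / lto x y}.
Proof. by move=> fm x y; rewrite /lto fm. Qed.

Lemma range_lto a b (f : a -> b) (c : b) :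
  range f = [set y | lto y c] -> forall x, lto (f x) c.
Proof.
move=> rf x; have : range f (f x) by exists x.
by rewrite rf.
Qed.

Lemma ord_leW a b : ord_lt a b -> ord_le a b.
Proof.
move=> [f fm [c rf]]; exists f => // x y yfx; rewrite rf /=.
apply/negP => cy; have /negP := range_lto rf x; apply.
exact: leo_trans yfx.
Qed.

Section Trichotomy.
Variables a b : Ord.

(* [omatch x y]: x and y have the same rank in their well-orders. *)
Inductive omatch : a -> b -> Prop := Omatch x y of
  (forall x', lto x' x -> exists2 y', lto y' y & omatch x' y') &
  (forall y', lto y' y -> exists2 x', lto x' x & omatch x' y') : omatch x y.

Let omatchl x y : omatch x y ->
  forall x', lto x' x -> exists2 y', lto y' y & omatch x' y'.
Proof. by case. Qed.

Let omatchr x y : omatch x y ->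
  forall y', lto y' y -> exists2 x', lto x' x & omatch x' y'.
Proof. by case. Qed.

Let omatch_fun x : forall y z, omatch x y -> omatch x z -> y = z.
Proof.
elim/lto_ind: x => x IH.
suff H y z : omatch x y -> omatch x z -> ~ lto y z.
  by move=> y z xy xz; apply: leo_anti; apply: leNo; exact: H.
move=> xy xz yz; have [x' x'x x'y] := omatchr xz yz.
have [y' y'y x'y'] := omatchl xy x'x.
by move: y'y; rewrite (IH _ x'x _ _ x'y' x'y) /lto leoxx.
Qed.

Let omatch_homo x x' y y' : omatch x y -> omatch x' y' -> lto x' x -> lto y' y.
Proof.
move=> xy x'y' /(omatchl xy)[z zy x'z].
by rewrite (omatch_fun x'y' x'z).
Qed.

Let omatch_inj x x' y : omatch x y -> omatch x' y -> x = x'.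
Proof.
move=> xy x'y; apply: leo_anti; apply: leNo => h.
  by have := omatch_homo xy x'y h; rewrite /lto leoxx.
by have := omatch_homo x'y xy h; rewrite /lto leoxx.
Qed.

Let omatch_mono x x' y y' : omatch x y -> omatch x' y' -> leo x x' = leo y y'.
Proof.
move=> xy x'y'; apply/idP/idP; apply: contraTT.
  by move=> /(omatchr xy)[z zx zy']; rewrite (omatch_inj x'y' zy').
exact: (omatch_homo xy x'y').
Qed.

Lemma ord_le_total : ord_le a b \/ ord_lt b a.
Proof.
have [dom|/existsNP[x0 nx0]] := pselect (forall x, exists y, omatch x y).
  left; have [f fP] := choice dom; exists f; first by move=> x y; rewrite (omatch_mono (fP x) (fP y)).
  move=> x y /leo_eqVlt[->|yfx]; first by exists x.
  by have [x' _ x'y] := omatchr (fP x) yfx; exists x' => //; exact: omatch_fun x'y.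
have [x nx xm] := @leo_min a (fun x => ~ exists y, omatch x y) (ex_intro _ x0 nx0).
have domx x' : lto x' x -> exists y, omatch x' y.
  by move=> x'x; apply: contrapT => /xm; apply/negP.
have [ran|/existsNP[y0 ny0]] := pselect (forall y, exists x, omatch x y).
  right; have [f fP] := choice ran.
  exists f; first by move=> y z; rewrite (omatch_mono (fP y) (fP z)).
  exists x; apply/seteqP; split => [_ [y _ <-]|x' /= /domx[y x'y]].
    rewrite /=; apply/negP => /leo_eqVlt[xE|xfy].
      by apply: nx; exists y; rewrite xE.
    by have [y' _ xy'] := omatchl (fP y) xfy; apply: nx; exists y'.
  by exists y => //; exact: omatch_inj x'y.
have [y ny ym] := @leo_min b (fun y => ~ exists x, omatch x y) (ex_intro _ y0 ny0).
exfalso; apply: (nx); exists y; constructor => [x' x'x|y' y'y].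
  have [y' x'y'] := domx _ x'x; exists y' => //; apply/negP => /leo_eqVlt[yE|yy'].
    by apply: ny; exists x'; rewrite yE.
  by have [z _ zy] := omatchr x'y' yy'; apply: ny; exists z.
have [x' x'y'] : exists x', omatch x' y'.
  by apply: contrapT => /ym; apply/negP.
exists x' => //; apply/negP => /leo_eqVlt[xE|xx'].
  by apply: nx; exists y'; rewrite xE.
by have [z _ zy] := omatchl x'y' xx'; apply: nx; exists z.
Qed.

End Trichotomy.

Lemma embed_ord_le a b (f : a -> b) : {mono f : x y / leo x y} -> ord_le a b.
Proof.
move=> fm; have [//|[g gm [c rg]]] := ord_le_total a b.
have gfc x : lto (g (f x)) c by exact: range_lto rg _.
suff /(_ c) : forall x, leo x (g (f x)) by move=> h; case/negP: (gfc c).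
move=> x; apply: contrapT => nx.
have [z nz zm] := @leo_min a (fun x => ~ leo x (g (f x))) (ex_intro _ x nx).
apply: (nz); apply: zm => h; apply: nz.
by move: h; rewrite gm fm.
Qed.

Definition is_omin (P : Ord -> Prop) (a : Ord) : Prop :=
  P a /\ forall b, P b -> ord_le a b.

Lemma exists_omin (P : Ord -> Prop) : (exists a, P a) -> exists a, is_omin P a.
Proof.
move=> [a Pa]; suff [b [Pb bm]] : exists b, P b /\ forall c, P c -> ~ ord_lt c b.
  by exists b; split => // c Pc; have [//|/bm] := ord_le_total b c.
have [am|] := pselect (forall c, P c -> ~ ord_lt c a); first by exists a.
move=> /existsNP[b0 /not_implyP[Pb0 /contrapT b0a]].
pose Q x := exists2 b, P b & exists2 f : b -> a, {mono f : x y / leo x y} &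
  range f = [set y | lto y x].
have [|x [b Pb [f fm rf]] xm] := @leo_min a Q.
  by have [f fm [x rf]] := b0a; exists x, b0 => //; exists f.
exists b; split => // c Pc [g gm [y rg]].
have := range_lto rf y.
apply/negP; rewrite negbK; apply: xm; exists c => //; exists (f \o g).
  by move=> u v; rewrite /= fm gm.
apply/seteqP; split => [_ [u _ <-]|z /= zfy].
  by rewrite /= (mono_lto fm); exact: range_lto rg u.
have [v _ vz] : range f z.
  by rewrite rf; apply: lto_trans zfy _; exact: range_lto rf y.
have [u _ uv] : range g v by rewrite rg /= -(mono_lto fm) vz.
by exists u => //=; rewrite uv.
Qed.

End OrdOrder.

Lemma void_wo : well_order (fun _ _ : void => true).
Proof. by move=> A [[]]. Qed.
Definition ord_zero : Ord := MkOrd void_wo.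

Lemma unit_wo : well_order (fun _ _ : unit => true).
Proof. by move=> A [[] Ax]; exists tt; split => [|[]//]; split. Qed.
Definition ord_one : Ord := MkOrd unit_wo.

(* Least element of a family of ordinals; [ord_zero] for the empty family. *)
Definition omin (P : Ord -> Prop) : Ord :=
  if pselect (exists a, is_omin P a) is left e then sval (cid e) else ord_zero.

Lemma ominP (P : Ord -> Prop) : (exists a, P a) -> is_omin P (omin P).
Proof.
move=> /exists_omin e; rewrite /omin; case: pselect => // {}e.
by case: (cid e).
Qed.

Section Sup.
Variables (I : Type) (f : I -> Ord).

Lemma exists_wo (T : Type) : exists R : rel T, well_order R.
Proof. by have [R] := well_ordering_principle {classic T}; exists R. Qed.

Lemma ord_lt_sup : exists a, forall i, ord_lt (f i) a.
Proof.
have [R Rwo] := exists_wo I; pose J := MkOrd Rwo.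
pose T := option {i : I & f i}.
pose le (p q : T) : Prop := match p, q with
  | _, None => True
  | None, Some _ => False
  | Some p, Some q => @lto J (tag p) (tag q) \/
      exists e : tag p = tag q, leo (eq_rect _ (fun i => f i) (tagged p) _ e) (tagged q)
  end.
have wo : well_order (fun p q => `[< le p q >]).
  apply: antisymmetric_well_order.
    move=> [p|] [q|]; last by [].
    - case: p q => [i x] [j y] /andP[/asboolP/= p /asboolP/= q].
      case: p => [ij|[e xy]].
        case: q => [ji|[e _]].
          by have := lto_trans ij ji; rewrite /lto leoxx.
        by exfalso; move: ij; rewrite e /lto (@leoxx J).
      case: q => [ji|[e' yx]]; first by exfalso; move: ji; rewrite /lto -e (@leoxx J).
      case: j / e y e' yx xy => y e'.
      rewrite (Prop_irrelevance e' erefl)/= => yx xy.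
      by rewrite (leo_anti xy yx).
    - by move=> /andP[_ /asboolP].
    - by move=> /andP[/asboolP].
  move=> P [p Pp].
  have [[p' Pp']|nP] := pselect (exists p, Some p \in P); last first.
    exists None; split.
      by case: p Pp => // p Pp; exfalso; apply: nP; exists p.
    by move=> [q|_]; [move=> Pq; exfalso; apply: nP; exists q|apply/asboolP].
  pose Q (i : J) := exists x : f i, (Some (existT _ i x) : T) \in P.
  have Q0 : exists i, Q i by case: p' Pp' => i x Pix; exists i, x.
  have [i [x ix] im] := leo_min Q0.
  have [{}x {}ix xm] := leo_min (ex_intro (fun x => (Some (existT _ i x) : T) \in P) x ix).
  exists (Some (Tagged f x)); split => // -[[j y] jy|_]; apply/asboolP => //=.
  have /leo_eqVlt[ij|] : @leo J i j by apply: im; exists y.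
    by right; exists ij; case: j / ij y jy => y /=; exact: xm.
  by left.
pose S := MkOrd wo.
exists S => i; have [[g gm _]|//] := ord_le_total S (f i).
pose h (x : f i) : S := Some (Tagged f x).
have hm : {mono h : x y / leo x y}.
  move=> x y; apply/asboolP/idP => /= [[|[e]]|xy].
  - by rewrite /lto (@leoxx J).
  - by rewrite (Prop_irrelevance e erefl).
  - by right; exists erefl.
have hlt x : lto (h x) (None : S) by apply/asboolP.
suff H : forall x, leo x (g (h x)).
  by have := H (g None); rewrite gm => H'; case/negP: (hlt (g None)).
elim/lto_ind => x IH; apply: contrapT => /negP nx.
by have := IH _ nx; rewrite gm hm => H; case/negP: nx.
Qed.

End Sup.

Definition is_succ (a : Ord) : Prop := exists m : a, forall x, leo x m.

Definition cof (a : Ord) : Ord :=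
  omin (fun l => exists f : l -> a, forall x, exists i, leo x (f i)).

(* A cardinal is an initial ordinal. *)
Definition is_card (k : Ord) : Prop :=
  forall x : k, ~ ([set: k] #<= [set y | lto y x]).

Definition uncountable_regular_card (k : Ord) : Prop :=
  [/\ is_card k, ~ countable [set: k] & ord_eq (cof k) k].

(* Binary sequences of length < k; [tag s] is the length of s. *)
Definition binseq (k : Ord) : Type := {g : k & {y : k | lto y g} -> bool}.

Definition cantor (k : Ord) : Type := k -> bool.

Definition cylinder (k : Ord) (s : binseq k) : set (cantor k) :=
  [set x | forall y, x (sval y) = tagged s y].

HB.instance Definition _ (k : Ord) := Choice.copy (cantor k) (k -> bool).

HB.instance Definition _ (k : Ord) :=
  isSubBaseTopological.Build (cantor k) (range (@cylinder k)) id.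

Definition weight_le (X : topologicalType) (k : Ord) : Prop :=
  exists2 B : set (set X), basis B & B #<= [set: k].

Section Borel.
Variables (k : Ord) (X : topologicalType).
Implicit Types (a b : Ord) (A : set X) (F : set (set X)).

(* The recursion on the ordinal is rendered by an inductive predicate;
   its defining equations are [kSigma1] and [kSigmaE]. *)
Inductive kSigma : Ord -> set (set X) :=
| kSigma_open a A of ord_eq a ord_one & open A : kSigma a A
| kSigma_bigcup a F of ord_lt ord_one a & F #<= [set: k] &
    (forall A, F A -> exists b,
      [/\ ord_le ord_one b, ord_lt b a & kSigma b (~` A)]) :
    kSigma a (\bigcup_(A in F) A).

Lemma kSigma_nested_ind (P : Ord -> set X -> Prop) :
  (forall a A, ord_eq a ord_one -> open A -> P a A) ->
  (forall a F, ord_lt ord_one a -> F #<= [set: k] ->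
    (forall A, F A -> exists b,
      [/\ ord_le ord_one b, ord_lt b a & kSigma b (~` A) /\ P b (~` A)]) ->
    P a (\bigcup_(A in F) A)) ->
  forall a A, kSigma a A -> P a A.
Proof.
move=> Po PU; exact: (fix IH a A (aA : kSigma a A) {struct aA} : P a A :=
  match aA with
  | kSigma_open a A a1 oA => Po a A a1 oA
  | kSigma_bigcup a F a1 Fk FP => PU a F a1 Fk (fun A FA =>
      match FP A FA with
      | ex_intro b (And3 b1 ba bA) =>
          ex_intro _ b (And3 b1 ba (conj bA (IH b (~` A) bA)))
      end)
  end).
Qed.

Definition kPi a : set (set X) := [set A | kSigma a (~` A)].

Definition kDelta a : set (set X) := kSigma a `&` kPi a.

Definition kBor : set (set X) :=
  smallest [set M | (forall A, M A -> M (~` A)) /\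
                    (forall F, F `<=` M -> F #<= [set: k] ->
                       M (\bigcup_(A in F) A))] open.

Definition ord_kBor : Ord := omin (fun a => ord_le ord_one a /\ kSigma a = kBor).

Lemma ord_lt1N a : ord_eq a ord_one -> ~ ord_lt ord_one a.
Proof.
move=> [f [g fK gK] fm] [h hm [c rh]].
have := range_lto rh tt; rewrite (_ : h tt = c) /lto ?leoxx//.
by rewrite -(fK c) -(fK (h tt)); case: (f c); case: (f (h tt)).
Qed.

Lemma kSigma1 a : ord_eq a ord_one -> kSigma a = open.
Proof.
move=> a1; apply/seteqP; split => A; last exact: kSigma_open.
by move=> aA; case: aA a1 => // b F b1 _ _ /ord_lt1N.
Qed.

Lemma kSigmaE a : ord_lt ord_one a ->
  kSigma a = [set \bigcup_(A in F) A | F in [set F | F #<= [set: k] /\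
    F `<=` [set A | exists b,
                      [/\ ord_le ord_one b, ord_lt b a & kPi b A]]]].
Proof.
move=> a1; apply/seteqP; split => [A aA|_ [F [Fk FP] <-]].
  case: aA a1 => [b B b1 _ /(ord_lt1N b1)//|b F _ Fk FP _].
  by exists F.
exact: kSigma_bigcup.
Qed.

End Borel.

Arguments kSigma k X a : clear implicits.
Arguments kPi k X a : clear implicits.
Arguments kDelta k X a : clear implicits.
Arguments kBor k X : clear implicits.
Arguments ord_kBor k X : clear implicits.
Arguments kSigma_bigcup {k X a F}.

(* For k nonempty, the family defining [ord_kBor] is nonempty ([ord_kBorP]), so
   that [ord_kBor] is never the default value of [omin]. *)
Section BorelOrder.
Variables (k : Ord) (X : topologicalType) (k0 : [set: k] !=set0).

Lemma kSigma_kBor a : kSigma k X a `<=` kBor k X.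
Proof.
move=> A; elim/kSigma_nested_ind: a A / => [a A _ oA|a F _ Fk FP] M kM.
  by have [_ oM] := kM; exact: oM.
have [[MC MU] _] := kM; apply: MU => // A /FP[b [_ _ [_ bA]]].
by rewrite -[A]setCK; apply: MC; exact: bA.
Qed.

Lemma kSigma_setC a b A : ord_le ord_one b -> ord_lt b a -> ord_lt ord_one a ->
  kSigma k X b A -> kSigma k X a (~` A).
Proof.
move=> b1 ba a1 bA; rewrite -(bigcup_set1 id (~` A)).
apply: kSigma_bigcup => // [|_ ->]; last by exists b; rewrite setCK.
have [x _] := k0; apply: (@card_le_trans _ _ _ [set x]).
  by have := eq_card1 (~` A) x; rewrite card_eq_le => /andP[].
exact: subset_card_le.
Qed.

Lemma ord_le1 : ord_le ord_one ord_one.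
Proof. by exists id => // x y _; exists y. Qed.

Lemma kBor_kSigma A : kBor k X A -> exists b, ord_le ord_one b /\ kSigma k X b A.
Proof.
move=> BA; pose M B := exists b, ord_le ord_one b /\ kSigma k X b B.
apply: (BA M); split; last first.
  move=> B oB; exists ord_one; split; first exact: ord_le1.
  by apply: kSigma_open => //; exists id => //; exists id.
split=> [B [b [b1 bB]]|F FM Fk].
  have [c bc] := ord_lt_sup (fun x : bool => if x then b else ord_one).
  exists c; split; first exact: ord_leW (bc false).
  exact: kSigma_setC b1 (bc true) (bc false) bB.
have MC B : F B -> M (~` B).
  move=> /FM[b [b1 bB]].
  have [c bc] := ord_lt_sup (fun x : bool => if x then b else ord_one).
  exists c; split; first exact: ord_leW (bc false).
  exact: kSigma_setC b1 (bc true) (bc false) bB.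
pose I := {B : X -> Prop | F B}.
have [b bP] := choice (fun B : I => MC _ (svalP B)).
have [c bc] := ord_lt_sup (fun x : option I => if x is Some B then b B else ord_one).
exists c; split; first exact: ord_leW (bc None).
apply: kSigma_bigcup (bc None) Fk _ => B FB.
have [b1 bB] := bP (exist _ B FB).
by exists (b (exist _ B FB)); split => //; exact: bc (Some (exist _ B FB)).
Qed.

Lemma ord_kBorP :
  is_omin (fun a => ord_le ord_one a /\ kSigma k X a = kBor k X) (ord_kBor k X).
Proof.
apply: ominP; pose I := {A : X -> Prop | kBor k X A}.
have [b bP] := choice (fun A : I => kBor_kSigma (svalP A)).
have [c bc] := ord_lt_sup (fun x : option I => if x is Some A then b A else ord_one).
exists c; split; first exact: ord_leW (bc None).
apply/seteqP; split; first exact: kSigma_kBor.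
move=> A BA; have BCA : kBor k X (~` A).
  by move=> M kM; have [[MC _] _] := kM; apply: MC; exact: BA.
have [b1 bA] := bP (exist _ _ BCA); rewrite -[A]setCK.
exact: kSigma_setC b1 (bc (Some (exist _ _ BCA))) (bc None) bA.
Qed.

End BorelOrder.

Section Closure.
Variables (T : Type) (M : set (set T)).

Definition stable_setC : Prop := forall A, M A -> M (~` A).

(* Families of size l are indexed by l, repetitions allowed. *)
Definition stable_bigcup (l : Ord) : Prop :=
  forall A : l -> set T, (forall i, M (A i)) -> M (\bigcup_i A i).

Definition stable_bigcap (l : Ord) : Prop :=
  forall A : l -> set T, (forall i, M (A i)) -> M (\bigcap_i A i).

End Closure.

(* For k regular and a >= 1; an ordinal a >= 1 that is not a successor is a
   limit. *)
Definition ord_hat (k a : Ord) : Ord := if `[< is_succ a >] then k else cof a.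

(* Main.v *)
Require Import Defs.
From mathcomp Require Import all_boot all_order finmap all_classical wochoice.
From mathcomp Require Import topology.

Set Implicit Arguments.
Unset Strict Implicit.
Unset Printing Implicit Defensive.

Local Open Scope classical_set_scope.
Local Open Scope card_scope.

(** Everything reduces to one fact: for [1 <= a < ord_kBor k X], not every
    [Sigma_a] set is [Pi_a] ([kSigma_not_sub_kPi]).  Indeed, [Sigma_a] contains
    the open sets and is closed under unions of size [k], because [k * k] has
    size [k] ([kSigma_bigcup_stable]); if it were closed under complements as
    well, it would contain all [k]-Borel sets ([kSigma_setC_kBor]), against the
    minimality of [ord_kBor k X].

    Failure of closure under complements is then immediate, for [Sigma_a] and
    for [Pi_a].  For the unions, the point is that every [Sigma_a] set is a union
    of only [ord_hat k a] sets of the smaller class, so that closure of this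
    class under such unions would put [Sigma_a] inside [Pi_a]:
    - if [a > 1], it is a union of [ord_hat k a] sets of [Delta_a]
      ([kSigma_covered_kDelta]): the [k] many members of the defining union when
      [a] is a successor; when [a] is a limit, these members are grouped in
      [cof a] blocks, the [i]-th block collecting the members whose rank is below
      the [i]-th term of a cofinal sequence.  Each block is a [Sigma] set of some
      rank below [a];
    - if [a = 1], an open set is a union of [k] closed sets, by regularity and
      the bound on the weight ([regular_open_covered]), and even of [k] clopen
      sets in a subspace of the Cantor space, which has [k] cylinders
      ([cantor_open_covered]).
    Intersections follow by taking complements.

    The fact that open sets are unions of [k] closed sets is also what makes the
    hierarchy increasing ([kSigma_mono]); above level 1 this is clear from the
    definition. *)

(** * Ordinals *)

Lemma ord_lt_no_mono (a b : Ord) (f : b -> a) :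
  ord_lt a b -> ~ {mono f : x y / leo x y}.
Proof.
move=> [g gm [c rg]] fm.
suff /(_ c) : forall x, leo x (g (f x)) by apply/negP; exact: (range_lto rg).
elim/lto_ind => x IH; apply: contrapT => /negP nx.
by have := IH _ nx; rewrite gm fm; apply/negP.
Qed.

(** Together with [ord_lt_no_mono], this makes strict comparison the negation of
    embeddability, so that transitivity needs no handling of initial segments. *)
Lemma no_mono_ord_lt (a b : Ord) :
  (forall f : b -> a, ~ {mono f : x y / leo x y}) -> ord_lt a b.
Proof. by move=> nf; have [[f /nf]|] := ord_le_total b a. Qed.

Lemma ord_le_lt_trans (a b c : Ord) : ord_le a b -> ord_lt b c -> ord_lt a c.
Proof.
move=> [g gm _] bc; apply: no_mono_ord_lt => f fm.
apply: (@ord_lt_no_mono b c (g \o f) bc) => x y.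
by rewrite /= gm fm.
Qed.

Lemma ord_lt_trans (a b c : Ord) : ord_lt a b -> ord_lt b c -> ord_lt a c.
Proof. by move=> /ord_leW; exact: ord_le_lt_trans. Qed.

Lemma ord_le1P (a : Ord) : ord_le ord_one a -> ord_eq a ord_one \/ ord_lt ord_one a.
Proof.
move=> [h hm _]; have [[f fm _]|] := ord_le_total a ord_one; last by right.
left; exists f => //; exists h => [x|y]; last by case: (f _); case: y.
by apply: (mono_inj_leo fm); case: (f x); case: (f _).
Qed.

Lemma ord_eq1_is_succ (a : Ord) : ord_eq a ord_one -> is_succ a.
Proof.
by move=> [f [g _ _] fm]; exists (g tt) => x; rewrite -fm.
Qed.

Section InitialSegment.
Variables (a : Ord) (x : a).

Lemma leo_sub_wo : well_order (fun y z : {y : a | lto y x} => leo (val y) (val z)).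
Proof.
move=> A [[y0 y0x] Ay0].
pose P y := exists yx : lto y x, (exist _ y yx : {y : a | lto y x}) \in A.
have [|y [yx Ay] ym] := @leo_min a P; first by exists y0, y0x.
exists (exist _ y yx); split.
  by split => // -[z zx] Az; apply: ym; exists zx.
move=> [z zx] [Az zm]; apply: val_inj => /=; apply: leo_anti.
  by apply: ym; exists zx.
exact: (zm (exist _ y yx)).
Qed.

Definition ord_seg : Ord := MkOrd leo_sub_wo.

Lemma ord_seg_lt : ord_lt ord_seg a.
Proof.
exists val => //; exists x; apply/seteqP; split => [_ [[y yx] _ <-]//|y yx].
by exists (exist _ y yx).
Qed.

End InitialSegment.

Lemma ord_lt_seg (a b : Ord) (f : b -> a) (c x : a) :
  {mono f : x y / leo x y} -> range f = [set y | lto y c] -> lto c x ->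
  ord_lt b (ord_seg x).
Proof.
move=> fm rf cx.
have fx y : lto (f y) x by apply: lto_trans cx; exact: (range_lto rf).
exists (fun y => exist _ (f y) (fx y) : ord_seg x); first by move=> y z; exact: fm.
exists (exist _ c cx); apply/seteqP; split => [_ [y _ <-]|[z zx] /= zc].
  exact: (range_lto rf).
have [y _ yz] : range f z by rewrite rf.
by exists y => //; exact: val_inj.
Qed.

Lemma cof_cofinal (a : Ord) : exists f : cof a -> a, forall x, exists i, leo x (f i).
Proof.
have [|//] := @ominP (fun l => exists f : l -> a, forall x, exists i, leo x (f i)).
by exists a, id => x; exists x; exact: leoxx.
Qed.

Section RegularCardinal.
Variables (k : Ord) (k_reg : uncountable_regular_card k).

Lemma k_neq0 : [set: k] !=set0.
Proof.
have [_ ku _] := k_reg; apply/set0P/negP => /eqP k0; apply: ku.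
by rewrite k0; exact: countable0.
Qed.

(** With a last element, [k] would have cofinality 1, hence be equal to 1. *)
Lemma not_is_succ_k : ~ is_succ k.
Proof.
have [_ ku [g [h gK hK] gm]] := k_reg; move=> [m km]; apply: ku.
have [|_ cmin] := @ominP (fun l => exists f : l -> k, forall x, exists i, leo x (f i)).
  by exists k, id => x; exists x; exact: leoxx.
have [|e em _] := cmin ord_one; first by exists (fun=> m) => x; exists tt.
apply/countable_injP; exists (fun=> 0%N) => x y _ _ _.
rewrite -(hK x) -(hK y); congr g; apply: (mono_inj_leo em).
by case: (e _); case: (e _).
Qed.

Lemma strict_succ : exists s : k -> k,
  forall x, lto x (s x) /\ forall y, lto x y -> leo (s x) y.
Proof.
suff s_ex (x : k) : exists y, lto x y /\ forall z, lto x z -> leo y z.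
  by have [s sP] := choice s_ex; exists s.
have [|y xy ym] := @leo_min k (fun y => lto x y); last by exists y.
apply: contrapT => nx; apply: not_is_succ_k; exists x => y.
by apply: leNo => xy; apply: nx; exists y.
Qed.

Lemma tagged_eq (s t : binseq k) z zs zt : s = t ->
  tagged s (exist _ z zs) = tagged t (exist _ z zt).
Proof. by move=> st; subst t; rewrite (Prop_irrelevance zs zt). Qed.

(** A pair is coded by a binary sequence: with [m <= M] the minimum and the maximum
    of the pair, the length [M + 2] of the sequence gives [M], its restriction to
    [M + 1] is the indicator of the elements below [m], and its last bit tells in
    which order [m] and [M] appear. *)
Lemma card_prod_binseq : [set: k * k] #<= [set: binseq k].
Proof.
have [s sP] := strict_succ.
have s_inj : injective s.
  suff s_lt x y : lto x y -> s x <> s y.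
    move=> x y sxy; apply: leo_anti; apply: leNo => /s_lt; exact.
  by move=> xy sxy; have [_ /(_ _ xy)] := sP x; rewrite sxy; apply/negP; case: (sP y).
pose M (p : k * k) := if leo p.1 p.2 then p.2 else p.1.
pose m (p : k * k) := if leo p.1 p.2 then p.1 else p.2.
pose c p : binseq k := existT (fun g => {y : k | lto y g} -> bool) (s (s (M p)))
  (fun z => lto (sval z) (m p) || (`[< sval z = s (M p) >] && leo p.1 p.2)).
have mM p : leo (m p) (M p).
  by rewrite /m /M; have := leo_total p.1 p.2; case: ifP => // ->.
have ltsM p : lto (s (M p)) (s (s (M p))) by case: (sP (s (M p))).
have ltM p : lto (M p) (s (M p)) by case: (sP (M p)).
have ltm p : lto (m p) (s (M p)).
  by apply/negP => /leo_trans /(_ (mM p)); apply/negP; exact: ltM.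
suff c_inj : injective c.
  have /card_esym := @inj_card_eq _ _ [set: k * k] c (in2W c_inj).
  by rewrite card_eq_le => /andP[/card_le_trans-> //]; exact: card_leT.
(* Equal codes are read at the last position to recover the order bit. *)
suff m_eq p q : c p = c q -> lto (m p) (m q) -> False.
  move=> p q cpq; have Mpq : M p = M q by apply/s_inj/s_inj; exact: (congr1 tag cpq).
  have mpq : m p = m q.
    by apply: leo_anti; apply: leNo; [exact: (m_eq q p)|exact: (m_eq p q)].
  have ltsMq : lto (s (M p)) (s (s (M q))) by rewrite Mpq.
  have /= := @tagged_eq (c p) (c q) _ (ltsM p) ltsMq cpq.
  rewrite -Mpq -mpq asboolT //= (negbTE (_ : ~~ lto (s (M p)) (m p))); last first.
    by rewrite /lto negbK; exact: ltoW.
  move: Mpq mpq; rewrite /M /m; case: p q {cpq ltsMq} => [x y] [u v] /= + + /= xyuv.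
  by rewrite xyuv; case: ifP => _ -> ->.
(* If the minima differ, the codes differ at the position of the smaller one. *)
move=> cpq mpq; have Mpq : M p = M q by apply/s_inj/s_inj; exact: (congr1 tag cpq).
have zp : lto (m p) (s (s (M p))) by exact: lto_trans (ltsM p).
have zq : lto (m p) (s (s (M q))) by rewrite -Mpq.
have /= := @tagged_eq (c p) (c q) _ zp zq cpq.
rewrite mpq /= {1}/lto leoxx /= => /andP[/asboolP mE _].
by have := ltm p; rewrite -mE /lto leoxx.
Qed.

End RegularCardinal.

Lemma card_le_range (k : Ord) (T : Type) (A : set T) :
  A !=set0 -> A #<= [set: k] -> exists f : k -> T, A = range f.
Proof.
move=> /set0P A0 /pfcard_geP[A_eq0|/surjfunPex//].
by rewrite A_eq0 eqxx in A0.
Qed.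

Lemma regular_card_prod (k : Ord) : uncountable_regular_card k ->
  [set: binseq k] #= [set: k] ->
  exists p : k -> k * k, [set: k * k] = range p.
Proof.
move=> k_reg; rewrite card_eq_le => /andP[bk _].
have [x _] := k_neq0 k_reg.
apply: card_le_range; first by exists (x, x).
exact: card_le_trans (card_prod_binseq k_reg) bk.
Qed.

(** * Unions indexed by an ordinal *)

Section Covered.
Variables (T : Type).
Implicit Types (M : set (set T)) (l : Ord) (A : set T).

Definition covered M l A : Prop :=
  exists2 G : l -> set T, (forall i, M (G i)) & A = \bigcup_i G i.

Lemma covered_sub M N l A : M `<=` N -> covered M l A -> covered N l A.
Proof. by move=> MN [G GM ->]; exists G => // i; exact: MN. Qed.

Lemma covered_stable M l A : stable_bigcup M l -> covered M l A -> M A.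
Proof. by move=> Ml [G GM ->]; exact: Ml. Qed.

(** A union of [l] unions of size [l] is reindexed along an enumeration of
    [l * l] by [l]. *)
Lemma covered_covered M l A : (exists p : l -> l * l, [set: l * l] = range p) ->
  covered (covered M l) l A -> covered M l A.
Proof.
move=> [p pE] [G GM ->].
have [H HP] := choice (fun i => let: ex_intro2 H HM GE := GM i in
  ex_intro (fun H => (forall j, M (H j)) /\ G i = \bigcup_j H j) H (conj HM GE)).
exists (fun i => H (p i).1 (p i).2) => [i|]; first by have [] := HP (p i).1.
apply/seteqP; split => [x [i _]|x [i _ xH]].
  have [_ ->] := HP i; case=> j _ xH.
  have [n _ nE] : range p (i, j) by rewrite -pE.
  by exists n => //; rewrite nE.
by exists (p i).1 => //; have [_ ->] := HP (p i).1; exists (p i).2.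
Qed.

Lemma stable_bigcapC M l : stable_bigcap M l -> stable_bigcup [set A | M (~` A)] l.
Proof. by move=> Ml A MA; rewrite /= setC_bigcup; exact: Ml. Qed.

Lemma basis_covered (M : set (set T)) (k : Ord) (B : k -> set T) (U : set T) :
  M set0 -> (forall i, B i `<=` U -> M (B i)) ->
  (forall x, U x -> exists2 i, B i x & B i `<=` U) -> covered M k U.
Proof.
move=> M0 MB BU; exists (fun i => if pselect (B i `<=` U) then B i else set0).
  by move=> i; case: pselect => // BiU; exact: MB.
apply/seteqP; split => [x /BU[i Bix BiU]|x [i _]]; last by case: pselect => // BiU /BiU.
by exists i => //; case: pselect.
Qed.

End Covered.

(** * The hierarchy *)

Section Hierarchy.
Variables (k : Ord) (X : topologicalType).
Hypothesis k0 : [set: k] !=set0.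
Implicit Types (a b : Ord) (A : set X).

Definition kPi_below a : set (set X) :=
  [set A | exists b, [/\ ord_le ord_one b, ord_lt b a & kPi k X b A]].

(** The family in the definition of [Sigma_a] may be empty, while [k] is not: the
    empty union is then written with copies of the empty set, a closed set. *)
Lemma kSigma_covered a A : ord_lt ord_one a ->
  kSigma k X a A <-> covered (kPi_below a) k A.
Proof.
move=> a1; rewrite kSigmaE //; split => [[F [Fk FP] <-]|[G GP ->]].
  have [->|/set0P F0] := eqVneq F set0.
    exists (fun=> set0) => [_|]; last by rewrite bigcup_set0 bigcup0.
    exists ord_one; split => //; first exact: ord_le1.
    by rewrite /kPi /= setC0 kSigma1; [exact: openT|exists id => //; exists id].
  have [f FE] := card_le_range F0 Fk; exists f.
    by move=> i; apply: FP; rewrite FE; exists i.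
  by rewrite FE bigcup_image.
exists (range G); last by rewrite bigcup_image.
split; first exact: card_image_le.
by move=> _ [i _ <-]; exact: GP.
Qed.

Lemma kPi_below_kSigma a : ord_lt ord_one a -> kPi_below a `<=` kSigma k X a.
Proof.
move=> a1 A [b [b1 ba bA]]; rewrite -[A]setCK.
exact: (kSigma_setC k0 b1 ba a1 bA).
Qed.

(** ** Spaces where open sets are unions of [k] closed sets *)

Section OpenFsigma.
Hypothesis open_closed : forall U : set X, open U -> covered closed k U.

Lemma kSigma_mono a b : ord_le ord_one b -> ord_lt b a ->
  kSigma k X b `<=` kSigma k X a.
Proof.
move=> b1 ba A; have a1 := ord_le_lt_trans b1 ba.
have [b_eq1|b_gt1] := ord_le1P b1.
  rewrite kSigma1 // => /open_closed[G Gc ->]; apply/kSigma_covered => //.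
  exists G => // i; exists b; split => //.
  by rewrite /kPi /= kSigma1 //; exact: closed_openC.
move=> /(kSigma_covered _ b_gt1) bA; apply/kSigma_covered => //.
apply: covered_sub bA => C [c [c1 cb cC]]; exists c; split => //.
exact: ord_lt_trans ba.
Qed.

Lemma kPi_below_kDelta a : ord_lt ord_one a -> kPi_below a `<=` kDelta k X a.
Proof.
move=> a1 A Aa; split; first exact: kPi_below_kSigma.
by have [b [b1 ba]] := Aa; exact: kSigma_mono.
Qed.

Lemma kSigma_kDelta a b : ord_le ord_one b -> ord_lt b a ->
  kSigma k X b `<=` kDelta k X a.
Proof.
move=> b1 ba A bA; split; first exact: kSigma_mono bA.
by apply: (kSigma_setC k0 b1 ba) => //; exact: ord_le_lt_trans ba.
Qed.

Hypothesis k_prod : exists p : k -> k * k, [set: k * k] = range p.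

Lemma kSigma_bigcup_stable a : ord_le ord_one a -> stable_bigcup (kSigma k X a) k.
Proof.
move=> /ord_le1P[a1|a1] A aA.
  by move: aA; rewrite kSigma1 // => oA; exact: bigcup_open.
apply/kSigma_covered => //; apply: covered_covered => //.
by exists A => // i; apply/kSigma_covered.
Qed.

Lemma open_kSigma a : ord_le ord_one a -> open `<=` kSigma k X a.
Proof.
have one1 : ord_eq ord_one ord_one by exists id => //; exists id.
move=> a1; have [a_eq1|a_gt1] := ord_le1P a1; first by rewrite kSigma1.
by rewrite -(kSigma1 k X one1); apply: kSigma_mono => //; exact: ord_le1.
Qed.

Lemma kSigma_setC_kBor a : ord_le ord_one a -> stable_setC (kSigma k X a) ->
  kSigma k X a = kBor k X.
Proof.
move=> a1 aC; apply/seteqP; split; first exact: kSigma_kBor.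
move=> A; apply; split; last exact: open_kSigma.
split => // F Fa Fk; have [->|/set0P F0] := eqVneq F set0.
  by rewrite bigcup_set0; apply: open_kSigma => //; exact: open0.
have [f FE] := card_le_range F0 Fk; rewrite FE bigcup_image.
by apply: kSigma_bigcup_stable => // i; apply: Fa; rewrite FE; exists i.
Qed.

(** Inclusion of [Sigma_a] in [Pi_a] is literally closure of [Sigma_a] under
    complements. *)
Lemma kSigma_not_sub_kPi a : ord_le ord_one a -> ord_lt a (ord_kBor k X) ->
  ~ kSigma k X a `<=` kPi k X a.
Proof.
move=> a1 a_lt SP; have [_ /(_ a) []] := ord_kBorP X k0.
  by split => //; exact: kSigma_setC_kBor.
by move=> f fm _; exact: ord_lt_no_mono a_lt fm.
Qed.

(** For limit [a] the members of the union are grouped along a cofinal sequence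
    [f]: the [i]-th block consists of the members of rank below [s (f i)], where
    [s (f i) > f i] exists because [a] has no last element; the strict inequality
    makes room for the additional level that a union of these members requires. *)
Lemma kSigma_covered_kDelta a A : ord_lt ord_one a -> kSigma k X a A ->
  covered (kDelta k X a) (ord_hat k a) A.
Proof.
move=> a1 /(kSigma_covered _ a1) aA; rewrite /ord_hat; case: asboolP => [_|a_lim].
  by apply: covered_sub aA; exact: kPi_below_kDelta.
have [f f_cof] := cof_cofinal a.
have [G Ga GE] := aA.
have s_ex (x : a) : exists y, lto x y.
  apply: contrapT => nx; apply: a_lim; exists x => y.
  by apply: leNo => xy; apply: nx; exists y.
have [s s_lt] := choice s_ex.
pose P i : set X -> Prop := kPi_below (ord_seg (s (f i))).
exists (fun i => \bigcup_(j in [set j | P i (G j)]) G j) => [i|]; last first.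
  rewrite GE; apply/seteqP; split => [x [j _ Gjx]|x [i _ [j _ Gjx]]]; last by exists j.
  have [b [b1 [g gm [c gE]] bG]] := Ga j; have [i ci] := f_cof c.
  exists i => //; exists j => //; exists b; split => //.
  apply: ord_lt_seg gm gE _; apply/negP => /leo_trans /(_ ci).
  by apply/negP; exact: s_lt.
(* A nonempty block has rank above 1, as the definition of [kSigma] by unions
   requires; the empty ones are dealt with as open sets. *)
have [j0|jN] := pselect (exists j, P i (G j)); last first.
  rewrite bigcup0 => [|j /= Pj]; last by exfalso; apply: jN; exists j.
  split; apply: open_kSigma; rewrite ?setC0; try exact: ord_leW; first exact: open0.
  exact: openT.
have seg_gt1 : ord_lt ord_one (ord_seg (s (f i))).
  by have [j [b [b1 bi _]]] := j0; exact: ord_le_lt_trans bi.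
apply: (kSigma_kDelta (ord_leW seg_gt1) (ord_seg_lt _)).
rewrite -(bigcup_image _ G id); apply: kSigma_bigcup => //.
  by apply: card_le_trans (card_image_le _ _) _; exact: card_leT.
by move=> _ [j Pj <-].
Qed.

End OpenFsigma.
End Hierarchy.

(** * Covering open sets *)

Lemma regular_open_covered (k : Ord) (X : topologicalType) :
  [set: X] !=set0 -> regular_space X -> weight_le X k ->
  forall U : set X, open U -> covered closed k U.
Proof.
move=> [x0 _] X_reg [B [Bo Bb] Bk] U oU.
have [|e BE] := card_le_range _ Bk.
  by have [V [BV _] _] := Bb x0 setT filterT; exists V.
apply: (@basis_covered _ _ _ (fun i => closure (e i))) => [|i _|x Ux].
- exact: closed0.
- exact: closed_closure.
have [V xV VU] := X_reg x U (open_nbhs_nbhs (conj oU Ux)).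
have [W [BW Wx] WV] := Bb x V xV; move: BW; rewrite BE => -[i _ iW].
exists i; first by rewrite iW; exact: subset_closure.
by rewrite iW; apply: subset_trans VU; exact: closure_subset.
Qed.

Section Cantor.
Variables (k : Ord).

Definition restrict (x : cantor k) (g : k) : binseq k :=
  existT (fun g => {y : k | lto y g} -> bool) g (fun z => x (sval z)).

Lemma cylinder_restrict (x y : cantor k) (g : k) :
  cylinder (restrict x g) y <-> forall z, lto z g -> y z = x z.
Proof.
split=> [xy z zg|xy [z zg]]; last by rewrite /= xy.
exact: (xy (exist _ z zg)).
Qed.

Lemma cylinder_open (s : binseq k) : open (cylinder s).
Proof.
exists [set cylinder s]; last by rewrite bigcup_set1.
by move=> _ ->; apply: finI_from1; exists s.
Qed.

(** Sequences outside a cylinder are separated from it by the cylinders of the same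
    length. *)
Lemma cylinder_closed (s : binseq k) : closed (cylinder s).
Proof.
rewrite -openC; rewrite (_ : ~` cylinder s =
    \bigcup_(x in ~` cylinder s) cylinder (restrict x (tag s))).
  by apply: bigcup_open => x _; exact: cylinder_open.
apply/seteqP; split=> [x sx|y [x sx /cylinder_restrict xy] sy].
  by exists x => //; apply/cylinder_restrict.
by apply: sx => -[z zs]; rewrite -sy /= xy.
Qed.

Lemma cylinders_restrict (x : cantor k) (s : seq (set (cantor k))) :
  [set: k] !=set0 -> (forall C, C \in s -> range (@cylinder k) C /\ C x) ->
  exists g, forall C, C \in s -> cylinder (restrict x g) `<=` C.
Proof.
move=> [g0 _]; elim: s => [|C s IH] sP; first by exists g0.
have [|g gP] := IH; first by move=> C' C's; apply: sP; rewrite inE C's orbT.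
have [[t _ tC] Cx] := sP C (mem_head _ _).
pose h := if leo g (tag t) then tag t else g.
have gh : leo g h by rewrite /h; case: ifP => // _; exact: leoxx.
have th : leo (tag t) h.
  by rewrite /h; have := leo_total g (tag t); case: ifP => //= _ _; exact: leoxx.
have lth z u : leo u h -> lto z u -> lto z h.
  by move=> uh zu; apply/negP => /(leo_trans uh); apply/negP.
exists h => C'; rewrite inE => /predU1P[->|C's] y /cylinder_restrict yx.
  rewrite -tC => -[z zt]; rewrite yx; last exact: lth th zt.
  by move: Cx; rewrite -tC; exact.
by apply: (gP _ C's); apply/cylinder_restrict => z /(lth _ _ gh)/yx.
Qed.

(** The cylinders, given as a subbase, form a basis: by linearity of the lengths,
    finitely many cylinders around a point contain the longest of them. *)
Lemma open_cylinder (U : set (cantor k)) (x : cantor k) : [set: k] !=set0 ->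
  open U -> U x -> exists2 s, cylinder s x & cylinder s `<=` U.
Proof.
move=> k0 oU.
have [D sD <-] : exists2 D : set (set (cantor k)),
  D `<=` finI_from (range (@cylinder k)) id & \bigcup_(V in D) V = U := oU.
move=> [V DV Vx]; have [E ED EV] := sD _ DV.
have [C CE|g gP] := @cylinders_restrict x E k0.
  split; first exact: set_mem (ED _ CE).
  by move: Vx; rewrite -EV; exact.
exists (restrict x g); first exact/cylinder_restrict.
by move=> y gy; exists V => //; rewrite -EV => C /= CE; exact: gP CE _ gy.
Qed.

Lemma cantor_open_covered (S : set (cantor k)) (U : set S) :
  uncountable_regular_card k -> [set: binseq k] #= [set: k] ->
  open U -> covered (fun A : set S => open A /\ closed A) k U.
Proof.
move=> k_reg k_pow [V oV <-]; have k0 := k_neq0 k_reg.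
have val_cont : continuous (set_val : S -> cantor k) by exact: initial_continuous.
have [||e eE] := @card_le_range k _ [set: binseq k].
- have [g _] := k0.
  by exists (restrict (fun=> true) g).
- by move: k_pow; rewrite card_eq_le => /andP[].
apply: (@basis_covered _ _ _ (fun i => set_val @^-1` cylinder (e i))) => [|i _|x Vx].
- by split; [exact: open0|exact: closed0].
- split; first exact: open_comp (cylinder_open _).
  by apply: preimage_closed; [move=> x _; exact: val_cont|exact: cylinder_closed].
have [s sx sV] := open_cylinder k0 oV Vx.
have [i _ iE] : range e s by rewrite -eE.
by exists i; rewrite iE // => y /sV.
Qed.

End Cantor.

Theorem proposition4p2 (k : Ord) (X : topologicalType)
    (k_reg : uncountable_regular_card k)
    (k_pow : [set: binseq k] #= [set: k])
    (X_ne : [set: X] !=set0)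
    (X_reg : regular_space X) (X_haus : hausdorff_space X)
    (X_wt : weight_le X k)
    (a : Ord) (a_ge1 : ord_le ord_one a) (a_lt : ord_lt a (ord_kBor k X)) :
  (~ stable_setC (kSigma k X a) /\
   ~ stable_bigcap (kSigma k X a) (ord_hat k a)) /\
  (~ stable_setC (kPi k X a) /\
   ~ stable_bigcup (kPi k X a) (ord_hat k a)) /\
  (ord_lt ord_one a \/
   ord_eq a ord_one /\ (exists S : set (cantor k), X = (set_type S : topologicalType)) ->
   ~ stable_bigcup (kDelta k X a) (ord_hat k a) /\
   ~ stable_bigcap (kDelta k X a) (ord_hat k a)).
Proof.
have k0 := k_neq0 k_reg; have k_prod := regular_card_prod k_reg k_pow.
have X_cov := regular_open_covered X_ne X_reg X_wt.
have not_sub := kSigma_not_sub_kPi k0 X_cov k_prod a_ge1 a_lt.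
have hat1 : ord_eq a ord_one -> ord_hat k a = k.
  by move=> /ord_eq1_is_succ a_succ; rewrite /ord_hat asboolT.
have no_bigcup M : kSigma k X a `<=` covered M (ord_hat k a) -> M `<=` kPi k X a ->
    ~ stable_bigcup M (ord_hat k a).
  by move=> SM MP Ms; apply: not_sub => A /SM/(covered_stable Ms)/MP.
have Pi_unstable : ~ stable_bigcup (kPi k X a) (ord_hat k a).
  apply: no_bigcup => // A; have [a1|a1] := ord_le1P a_ge1; last first.
    move=> /(kSigma_covered_kDelta k0 X_cov a1); apply: covered_sub.
    exact: subIsetr.
  rewrite hat1 // kSigma1 // => /X_cov; apply: covered_sub => C Cc.
  by rewrite /kPi /= kSigma1 //; exact: closed_openC.
split; last split; first split.
- by move=> SC; apply: not_sub => A /SC.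
- by move=> /stable_bigcapC.
- split => // PC; apply: not_sub => A SA.
  by rewrite -[A]setCK; apply: PC; rewrite /kPi /= setCK.
move=> a_case.
have Delta_unstable : ~ stable_bigcup (kDelta k X a) (ord_hat k a).
  apply: no_bigcup; last exact: subIsetr.
  move=> A; have [a1|[a1 [S XS]]] := a_case.
    exact: kSigma_covered_kDelta.
  rewrite hat1 // kSigma1 // => oA.
  suff : covered (fun A : set X => open A /\ closed A) k A.
    by apply: covered_sub => C [oC cC]; split; rewrite /kPi /= kSigma1 //; exact: closed_openC.
  move: A oA; rewrite XS => A; exact: cantor_open_covered.
split=> // /stable_bigcapC DC; apply: Delta_unstable.
rewrite (_ : kDelta k X a = [set A | kDelta k X a (~` A)]) //.
by apply/seteqP; split => A; rewrite /kDelta /kPi /= setCK => -[].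
Qed.
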